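(* Let $\overline{\mathcal{S}}$ be the set of strict overpartitions: partitions $\lambda=(\lambda_1>\cdots>\lambda_\ell)$ into distinct positive parts in which a part $\lambda_i$ may be overlined only if $\lambda_i\ge2$ and $\lambda_i-\lambda_{i+1}\ge2$ (with $\lambda_{\ell+1}:=0$); the empty partition is included. Then $$\sum_{\lambda\in\overline{\mathcal{S}}}a^{\overline{\#}(\lambda)}q^{|\lambda|}=\sum_{n=0}^{\infty}\frac{(-aq;q)_{n}}{(q;q)_{n}}q^{\frac{n(n+1)}{2}}=(-aq^2;q^2)_{\infty}(-q;q)_{\infty}.$$
   Context: $\overline{\#}(\lambda)$ is the number of overlined parts and $|\lambda|$ the sum of the parts (ignoring overlines). $(a;q)_n=\prod_{i=0}^{n-1}(1-aq^i)$ for $n\in\mathbb{Z}_{\ge0}\cup\{\infty\}$, $|q|<1$. *)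

(* Defs.v *)
From mathcomp Require Export all_boot all_order all_algebra complex.
From mathcomp Require Export all_classical all_reals all_analysis.
(* Not imported: its [summable] would shadow the one of esum. *)
From mathcomp Require summability.

Set Implicit Arguments.
Unset Strict Implicit.
Unset Printing Implicit Defensive.

Export Order.TTheory GRing.Theory Num.Theory.
Export numFieldNormedType.Exports.

Local Open Scope classical_set_scope.
Local Open Scope ring_scope.

(* An overpartition is listed as pairs (part, is it overlined?). *)
Definition part (s : seq (nat * bool)) (i : nat) : nat := (nth (0%N, false) s i).1.
Definition overlined (s : seq (nat * bool)) (i : nat) : bool :=
  (nth (0%N, false) s i).2.

(* The default value of [nth] provides the convention that the part following
   the last one is 0. *)
Definition is_strict_overpartition (s : seq (nat * bool)) : bool :=
  [&& sorted gtn [seq p.1 | p <- s],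
      all (fun p => 0 < p.1)%N s
    & [forall i : 'I_(size s),
         overlined s i ==> (2 <= part s i)%N && (2 <= part s i - part s i.+1)%N]].

Definition strict_overpartition :=
  {s : seq (nat * bool) | is_strict_overpartition s}.

Definition num_overlined (l : strict_overpartition) : nat :=
  count (fun p => p.2) (val l).

Definition weight (l : strict_overpartition) : nat :=
  (\sum_(p <- val l) p.1)%N.

Definition qpoch (K : numFieldType) (a q : K) (n : nat) : K :=
  \prod_(0 <= i < n) (1 - a * q ^+ i).

(* [K^o] is K as a normed space over itself; [limn] is only meaningful when the
   partial products converge. *)
Definition qpoch_inf (K : numFieldType) (a q : K) : K :=
  limn (qpoch a q : nat -> K^o).

Definition overpartition_term (K : numFieldType) (a q : K)
    (l : strict_overpartition) : K^o :=
  a ^+ num_overlined l * q ^+ weight l.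

Definition basic_term (K : numFieldType) (a q : K) (n : nat) : K^o :=
  qpoch (- (a * q)) q n / qpoch q q n * q ^+ ((n * n.+1) %/ 2).

(* Main.v *)
Require Import Defs.
From mathcomp Require Import finmap zify ring.

Set Implicit Arguments.
Unset Strict Implicit.
Unset Printing Implicit Defensive.

Local Open Scope classical_set_scope.
Local Open Scope ring_scope.
Local Open Scope complex_scope.

(* Let x_N(n) be the sum of the terms of the strict overpartitions with n parts,
   all less than N. Classifying by the largest part gives a recurrence in N, which
   bounds sum_n x_N(n) for |a|, |q| by prod (1 + (1 + |a|) |q|^i) and thus yields
   absolute convergence. Classifying by the smallest part gives
   x_{N+2}(n+1) = q^{n+1} (x_{N+1}(n+1) + x_{N+1}(n)) + a q^{2n+2} x_N(n), whose
   limit in N is the recurrence of the general term t_n(a) of the basic series.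
   Since t_n(a) - (1 + a q^2) t_n(a q^2) telescopes, the sum S(a) satisfies
   S(a) = (1 + a q^2) S(a q^2); iterating, S(a) = (-a q^2; q^2)_oo S(0) by
   continuity at 0. Finally S(0), a sum over partitions into distinct parts, is
   (-q; q)_oo. *)

#[local] Existing Instance summability.totally_filter.

(** * Enumeration of strict overpartitions by their largest part *)

(** In [part s 0 + o < k] the boolean [o] counts as 1, which raises the required gap from 1 to 2
    under an overline. When [s] is empty, the default part 0 turns the same inequality into
    positivity of [k], or [2 <= k] if overlined. *)
Lemma is_strict_overpartition_cons k o s :
  is_strict_overpartition ((k, o) :: s)
  = is_strict_overpartition s && (part s 0 + o < k)%N.
Proof.
rewrite /is_strict_overpartition /=.
have -> : path gtn k [seq p.1 | p <- s] =
    sorted gtn [seq p.1 | p <- s] && ((s == [::]) || (part s 0 < k)%N).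
  by case: s => //= p s; rewrite andbC.
have -> : [forall i : 'I_(size s).+1, overlined ((k, o) :: s) i ==>
    (2 <= part ((k, o) :: s) i)%N
      && (2 <= part ((k, o) :: s) i - part ((k, o) :: s) i.+1)%N] =
  (o ==> (1 < k)%N && (1 < k - part s 0)%N) &&
  [forall i : 'I_(size s), overlined s i ==>
    (2 <= part s i)%N && (2 <= part s i - part s i.+1)%N].
  apply/forallP/andP => [h|[h0 /forallP h] i].
    split; first exact: (h ord0).
    by apply/forallP => i; exact: (h (lift ord0 i)).
  by case: (unliftP ord0 i) => [j ->|->]; [exact: h|exact: h0].
case: (eqVneq s [::]) => [->|sn0]; rewrite /=.
  by rewrite /part /= ?andbT; case: o => /=; lia.
case: (sorted _ _); case: (all _ _); rewrite /= ?andbF //.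
by case: [forall _, _]; rewrite ?andbF ?andbT //; case: o => /=; lia.
Qed.

(* An overlined largest part [M] forces all the other parts below [M - 1], whence
   the two-step recursion. *)
Fixpoint parts_lt (N : nat) : seq (seq (nat * bool)) :=
  if N is M.+1 then
    if M is K.+1 then
      parts_lt M ++ map (cons (M, false)) (parts_lt M)
                 ++ map (cons (M, true)) (parts_lt K)
    else [:: [::]]
  else [::].

Lemma parts_ltSS N : parts_lt N.+2 =
  parts_lt N.+1 ++ map (cons (N.+1, false)) (parts_lt N.+1)
                ++ map (cons (N.+1, true)) (parts_lt N).
Proof. by []. Qed.

Lemma nat_ind2 (P : nat -> Prop) :
  P 0 -> P 1 -> (forall n, P n -> P n.+1 -> P n.+2) -> forall n, P n.
Proof.
move=> P0 P1 PSS n; suff: P n /\ P n.+1 by case.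
by elim: n => // n [Pn PSn]; split=> //; exact: PSS.
Qed.

Lemma mem_map_cons (T : eqType) (x y : T) (s : seq T) (S : seq (seq T)) :
  (y :: s \in map (cons x) S) = (y == x) && (s \in S).
Proof.
apply/mapP/andP => [[t tS [-> ->]]|[/eqP -> sS]]; first by rewrite eqxx.
by exists s.
Qed.

(** The first part of the empty list is 0 by default, so nothing at all satisfies the bound for
    [N = 0]. The emptiness of [parts_lt 0] is also what keeps an overlined 1 out of [parts_lt 2]. *)
Lemma mem_parts_lt N s :
  (s \in parts_lt N) = is_strict_overpartition s && (part s 0 < N)%N.
Proof.
elim/nat_ind2: N s => [s|s|N IHN IHSN s].
- by rewrite /= in_nil ltn0 andbF.
- rewrite /= mem_seq1; case: s => [|[k o] s].
    rewrite eqxx /is_strict_overpartition /=; symmetry.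
    by rewrite andbT; apply/forallP => -[].
  rewrite is_strict_overpartition_cons [part (_ :: _) _]/part /=.
  by apply/esym/negbTE; lia.
rewrite parts_ltSS !mem_cat IHSN.
case: s => [|[k o] s].
  have nil_map x S : (([::] : seq (nat * bool)) \in map (cons x) S) = false.
    by apply/negbTE/mapP => -[].
  by rewrite !nil_map !orbF.
rewrite !mem_map_cons IHN IHSN !xpair_eqE !is_strict_overpartition_cons.
rewrite ![part (_ :: _) _]/part /=.
case: (is_strict_overpartition s); rewrite ?andbF ?andbT //=.
by case: o => /=; lia.
Qed.

Lemma uniq_parts_lt N : uniq (parts_lt N).
Proof.
have inj x : injective (cons x : seq (nat * bool) -> _) by move=> s t [].
elim/nat_ind2: N => // N uN uSN.
rewrite parts_ltSS !cat_uniq !map_inj_uniq // uN uSN /= andbT.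
apply/andP; split; last first.
  by apply/hasPn => _ /mapP[s _ ->]; rewrite /= mem_map_cons xpair_eqE andbF.
apply/hasPn => s sE; apply/negP.
change (s \in parts_lt N.+1 -> False).
rewrite mem_parts_lt => /andP[_].
by move: sE; rewrite mem_cat => /orP[] /mapP[t _ ->]; rewrite /part ltnn.
Qed.

(** * Recurrences for the sums truncated by the largest part *)

Section Recurrences.
Variables (K : comPzRingType) (a q : K).

Definition op_term (s : seq (nat * bool)) : K :=
  a ^+ count (fun p => p.2) s * q ^+ (\sum_(p <- s) p.1)%N.

Lemma op_term_cons k o s : op_term ((k, o) :: s) = a ^+ o * q ^+ k * op_term s.
Proof. by rewrite /op_term /= big_cons /= !exprD; ring. Qed.

Definition sum_parts_lt N : K := \sum_(s <- parts_lt N) op_term s.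

Definition sum_parts_lt_size N n : K :=
  \sum_(s <- parts_lt N | size s == n) op_term s.

Lemma sum_parts_ltSS N : sum_parts_lt N.+2 =
  (1 + q ^+ N.+1) * sum_parts_lt N.+1 + a * q ^+ N.+1 * sum_parts_lt N.
Proof.
rewrite /sum_parts_lt parts_ltSS !big_cat !big_map /=.
under [X in _ + (X + _)]eq_bigr do rewrite op_term_cons.
under [X in _ + (_ + X)]eq_bigr do rewrite op_term_cons.
by rewrite -!mulr_sumr; ring.
Qed.

Lemma sum_parts_lt_sizeSS N n : sum_parts_lt_size N.+2 n.+1 =
  sum_parts_lt_size N.+1 n.+1
  + q ^+ N.+1 * (sum_parts_lt_size N.+1 n + a * sum_parts_lt_size N n).
Proof.
rewrite /sum_parts_lt_size parts_ltSS !big_cat !big_map /=.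
under [X in _ + (X + _)]eq_bigr do rewrite op_term_cons.
under [X in _ + (_ + X)]eq_bigr do rewrite op_term_cons.
by rewrite -!mulr_sumr; ring.
Qed.

Lemma sum_parts_lt_size0 N : sum_parts_lt_size N.+1 0 = 1.
Proof.
elim: N => [|N IHN]; rewrite /sum_parts_lt_size.
  by rewrite /= big_cons big_nil /op_term big_nil /= !expr0 mulr1 addr0.
rewrite parts_ltSS !big_cat !big_map /= !big_pred0_eq !addr0; exact: IHN.
Qed.

(* This is the classification by the smallest part (1, or an overlined 2, or
   anything else), but it is cheaper to deduce it from the classification by the
   largest part than to biject lists. *)
Lemma sum_parts_lt_size_smallest N n : sum_parts_lt_size N.+2 n.+1 =
  q ^+ n.+1 * (sum_parts_lt_size N.+1 n.+1 + sum_parts_lt_size N.+1 n)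
  + a * q ^+ (2 * n.+1) * sum_parts_lt_size N n.
Proof.
have x0 m : sum_parts_lt_size 0 m = 0 by rewrite /sum_parts_lt_size big_nil.
have x1 m : sum_parts_lt_size 1 m.+1 = 0.
  by rewrite /sum_parts_lt_size /= big_cons big_nil.
elim/nat_ind2: N n => [n|n|N IHN IHSN n].
- rewrite sum_parts_lt_sizeSS x0 x1.
  by case: n => [|n]; rewrite ?x1 ?sum_parts_lt_size0; ring.
- rewrite sum_parts_lt_sizeSS !(sum_parts_lt_sizeSS 0) x1 !x0.
  case: n => [|[|n]]; rewrite ?sum_parts_lt_sizeSS ?x0 ?x1 ?sum_parts_lt_size0;
  by ring.
rewrite sum_parts_lt_sizeSS.
case: n => [|n].
  rewrite [in LHS]IHSN !sum_parts_lt_size0 (sum_parts_lt_sizeSS N.+1 0).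
  rewrite !sum_parts_lt_size0.
  rewrite !exprS; ring.
(* The two classifications commute: the left side, already split by the largest part, is split by
   the smallest through the induction hypotheses, and the right side is split by the largest part.
   The results agree as polynomials. *)
rewrite [in LHS](IHN n) [in LHS](IHSN n.+1) [in LHS](IHSN n).
rewrite [in RHS](sum_parts_lt_sizeSS N n) !(sum_parts_lt_sizeSS N.+1).
rewrite !mulnS !exprD !exprS.
ring.
Qed.

End Recurrences.

(** * Unconditional convergence along the net of finite sets *)

Section UnconditionalSums.
Variable I : choiceType.

Lemma partial_sumE (V : zmodType) (f : I -> V) (A : {fset I}) :
  summability.partial_sum f A = \sum_(i <- A) f i.
Proof. by rewrite /summability.partial_sum big_seq_fsetE. Qed.

Lemma le_partial_sum (K : numDomainType) (f : I -> K) (A B : {fset I}) :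
  (forall i, 0 <= f i) -> (A `<=` B)%fset ->
  summability.partial_sum f A <= summability.partial_sum f B.
Proof.
move=> f0 AB; rewrite !partial_sumE (big_fsetID _ (mem A) B) /=.
have -> : [fset x | x in B & x \in A]%fset = A.
  by apply/fsetP => i; rewrite !inE /= andb_idl // => /(fsubsetP AB).
by rewrite lerDl; apply: sumr_ge0 => i _.
Qed.

(** For nonnegative terms the net of partial sums is monotone, so it converges to its supremum. *)
Lemma cvg_partial_sum_ge0 (R : realType) (f : I -> R) (M : R) :
  (forall i, 0 <= f i) -> (forall A, summability.partial_sum f A <= M) ->
  cvg (summability.partial_sum f @ summability.totally).
Proof.
move=> f0 fM; set S := range (summability.partial_sum f).
have hS : has_sup S.
  split; first by exists (summability.partial_sum f fset0), fset0.
  by exists M => _ [A _ <-].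
apply: (cvgP (sup S)); apply/cvgrPdist_lt => e e0.
have [_ [A _ <-] ltA] := sup_adherent e0 hS.
exists A => //= B AB.
have leB : summability.partial_sum f B <= sup S.
  by apply: ub_le_sup; [case: hS|exists B].
rewrite ger0_norm ?subr_ge0 // ltrBlDr -ltrBlDl (lt_le_trans ltA) //.
exact: le_partial_sum.
Qed.

Lemma cvg_real_complex (R : realType) (T : Type) (F : set_system T)
    (FF : Filter F) (x : T -> R) (l : R) :
  x @ F --> l -> ((x t)%:C : R[i]^o) @[t --> F] --> (l%:C : R[i]^o).
Proof.
move=> xl; apply/cvgrPdist_lt => e e0.
have ereal : e = (complex.Re e)%:C by rewrite RRe_real // gtr0_real.
move: e0; rewrite ereal ltcR => e0.
move/cvgrPdist_lt: xl => /(_ _ e0); apply: filterS => t.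
by rewrite -rmorphB normc_def /= expr0n addr0 sqrtr_sqr ltcR.
Qed.

(** Reduction to the nonnegative real case: with [g0] the modulus of [f], the real part is
    [(g0 + Re f) - g0] and likewise for the imaginary part, where all families involved are
    nonnegative with bounded sums. *)
Lemma cvg_partial_sum (R : realType) (f : I -> R[i]^o) (M : R[i]) :
  (forall A : {fset I}, \sum_(i <- A) `|f i| <= M) ->
  cvg (summability.partial_sum f @ summability.totally).
Proof.
move=> fM; pose g0 i : R := complex.Re `|f i|.
have g0E i : (g0 i)%:C = `|f i| by rewrite RRe_real // normr_real.
have leRe i : `|complex.Re (f i)| <= g0 i by rewrite -lecR g0E normc_ge_Re.
have leIm i : `|complex.Im (f i)| <= g0 i.
  (* Multiplication by ['i] preserves the modulus and turns the imaginary part into a real part, up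
     to sign. *)
  rewrite -lecR g0E; have := normc_ge_Re (f i * 'i%C).
  by rewrite ReiNIm normrN normrM (_ : `|'i%C : R[i]| = 1) ?mulr1 // normc_def /=
    expr0n expr1n add0r sqrtr1.
have g0M A : \sum_(i <- A : {fset I}) g0 i <= complex.Re M.
  have := fM A; rewrite lecE => /andP[_]; congr (_ <= _).
  under [in LHS]eq_bigr do rewrite -g0E.
  by rewrite -rmorph_sum.
pose g1 i := g0 i + complex.Re (f i); pose g2 i := g0 i + complex.Im (f i).
have c0 : cvg (summability.partial_sum g0 @ summability.totally).
  apply: (@cvg_partial_sum_ge0 _ _ (complex.Re M)) => [i|A].
    by rewrite (le_trans _ (leRe i)).
  by rewrite partial_sumE.
have cg h : (forall i, `|h i| <= g0 i) ->
    cvg (summability.partial_sum (fun i => g0 i + h i) @ summability.totally).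
  move=> hg.
  apply: (@cvg_partial_sum_ge0 _ _ (complex.Re M + complex.Re M)) => [i|A].
    by have := hg i; rewrite ler_norml => /andP[+ _]; rewrite -subr_ge0 opprK
      addrC.
  rewrite partial_sumE big_split lerD //; apply: le_trans (g0M A).
  by apply: ler_sum => i _; rewrite (le_trans (ler_norm _)).
have c1 := cg _ leRe; have c2 := cg _ leIm.
have -> : summability.partial_sum f = fun A =>
    (((summability.partial_sum g1 A)%:C : R[i]^o)
      - (summability.partial_sum g0 A)%:C)
    + 'i%C * (((summability.partial_sum g2 A)%:C : R[i]^o)
      - (summability.partial_sum g0 A)%:C).
  apply/funext => A; rewrite !partial_sumE -!rmorphB -!sumrB !rmorph_sum.
  rewrite mulr_sumr -big_split /=; under eq_bigr do rewrite [f _]complexE.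
  by apply: eq_bigr => i _; rewrite /g1 /g2 ![g0 i + _]addrC !addrK.
have cc (g : I -> R) : cvg (summability.partial_sum g @ summability.totally) ->
    ((summability.partial_sum g A)%:C : R[i]^o) @[A --> summability.totally]
    --> ((lim (summability.partial_sum g @ summability.totally))%:C : R[i]^o).
  by move=> cvg_g; apply: cvg_real_complex.
have c10 := cvgB (cc _ c1) (cc _ c0); have c20 := cvgB (cc _ c2) (cc _ c0).
have FT : Filter (@summability.totally I) by exact: filter_filter.
apply: cvgP; exact: (cvgD (c10 FT) (@cvgMl_tmp R[i] _ _ _ _ 'i%C _ (c20 FT))).
Qed.

(** This turns unconditional sums into limits of sequences: finite sets that eventually contain any
    given one are cofinal in the net. *)
Lemma cvg_partial_sum_exhaust (V : topologicalType) (B : nat -> {fset I})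
    (g : {fset I} -> V) (l : V) :
  g @ summability.totally --> l ->
  (forall J, \forall N \near \oo, (J `<=` B N)%fset) ->
  g (B N) @[N --> \oo] --> l.
Proof.
move=> gl hB; apply: cvg_trans gl => U [J _ JU].
by apply: filterS (hB J) => N; exact: JU.
Qed.

End UnconditionalSums.

Lemma partial_sum_fset_seq (I : choiceType) (V : zmodType) (f : I -> V)
    (s : seq I) : uniq s ->
  summability.partial_sum f [fset i in s]%fset = \sum_(i <- s) f i.
Proof.
move=> us; rewrite partial_sumE; apply/perm_big/uniq_perm => //.
by move=> i; rewrite inE.
Qed.

Lemma fset_iota_exhaust (J : {fset nat}) :
  \forall N \near \oo, (J `<=` [fset i in iota 0 N])%fset.
Proof.
exists (\max_(i <- J) i).+1%N => // N /= ltN; apply/fsubsetP => i iJ.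
rewrite inE /= mem_iota add0n /=; apply: leq_trans ltN.
by rewrite ltnS; apply: leq_bigmax_seq.
Qed.

(** * Bounds on products and convergence of q-Pochhammer symbols *)

(** Each factor satisfies [1 + x <= expR x], and the exponents form a geometric series. *)
Lemma prod_geometric_le_exp (R : realType) (c r : R) (N : nat) :
  0 <= c -> 0 <= r < 1 ->
  \prod_(0 <= i < N) (1 + c * r ^+ i) <= expR (c / (1 - r)).
Proof.
move=> c0 /andP[r0 r1].
apply: (@le_trans _ _ (\prod_(0 <= i < N) expR (c * r ^+ i))).
  apply: ler_prod => i _; rewrite expR_ge1Dx andbT.
  by rewrite addr_ge0 // mulr_ge0 // exprn_ge0.
rewrite -expR_sum ler_expR.
have rn1 : r != 1 by rewrite lt_eqF.
have := geometric_seriesE c rn1.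
move=> /(congr1 (fun u => u N)); rewrite /series /geometric /= => ->.
rewrite ler_pM2r ?invr_gt0 ?subr_gt0 //.
by rewrite ler_piMr // gerBl exprn_ge0.
Qed.

Lemma prod_geometric_bounded (R : realType) (c q : R[i]) :
  0 <= c -> `|q| < 1 ->
  exists M : R[i], forall N, \prod_(0 <= i < N) (1 + c * `|q| ^+ i) <= M.
Proof.
move=> c0 q1.
have cE : c = (complex.Re c)%:C by rewrite RRe_real // ger0_real.
have qE : `|q| = (complex.Re `|q|)%:C by rewrite RRe_real // normr_real.
exists (expR (complex.Re c / (1 - complex.Re `|q|)))%:C => N.
rewrite qE [in X in X <= _]cE.
under eq_bigr do
  rewrite -rmorphXn -rmorphM -(rmorph1 (real_complex R)) -rmorphD.
rewrite -rmorph_prod lecR prod_geometric_le_exp //; first by rewrite -ler0c -cE.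
by rewrite -ler0c -qE normr_ge0 /= -ltcR -qE rmorph1.
Qed.

Lemma qpochS (K : numFieldType) (a q : K) N :
  qpoch a q N.+1 = qpoch a q N * (1 - a * q ^+ N).
Proof. by rewrite /qpoch big_nat_recr. Qed.

(** The increments of the partial products are dominated by those of the majorant [Q], which
    telescope and stay bounded; hence the increments are absolutely summable. *)
Lemma cvg_qpoch (R : realType) (a q : R[i]) :
  `|q| < 1 -> cvgn (qpoch a q : nat -> R[i]^o).
Proof.
move=> q1.
have [M QM] := prod_geometric_bounded (normr_ge0 a) q1.
pose Q N := \prod_(0 <= i < N) (1 + `|a| * `|q| ^+ i).
have QS N : Q N.+1 = Q N * (1 + `|a| * `|q| ^+ N) by rewrite /Q big_nat_recr.
have Q0 N : 0 <= Q N.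
  by apply: prodr_ge0 => i _; rewrite addr_ge0 // mulr_ge0 // exprn_ge0.
have PQ N : `|qpoch a q N| <= Q N.
  rewrite /qpoch normr_prod; apply: ler_prod => i _; rewrite normr_ge0 /=.
  by rewrite (le_trans (ler_normB _ _)) // normr1 normrM normrX.
pose f N : R[i]^o := qpoch a q N.+1 - qpoch a q N.
have fQ N : `|f N| <= Q N.+1 - Q N.
  rewrite /f qpochS QS !mulrDr !mulr1 ![_ + _ * _]addrC !addrK mulrN normrN.
  by rewrite !normrM normrX ler_pM // mulr_ge0 // exprn_ge0.
have fM (A : {fset nat}) : \sum_(i <- A) `|f i| <= M.
  have [N _ /(_ N (leqnn _)) AN] := fset_iota_exhaust A.
  rewrite -partial_sumE (le_trans (le_partial_sum _ AN)) //.
  rewrite partial_sum_fset_seq ?iota_uniq //.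
  apply: le_trans (ler_sum _ (fun i _ => fQ i)) _.
  have := telescope_sumr Q (leq0n N); rewrite /index_iota subn0 => ->.
  by rewrite (le_trans _ (QM N)) // gerBl.
have /cvg_ex[l fl] := cvg_partial_sum fM.
have := cvg_partial_sum_exhaust fl fset_iota_exhaust.
have -> : (fun N => summability.partial_sum f [fset i in iota 0 N]%fset) =
    (fun N => qpoch a q N - 1 : R[i]^o).
  apply/funext => N; rewrite partial_sum_fset_seq ?iota_uniq //.
  have := telescope_sumr (qpoch a q) (leq0n N); rewrite /index_iota subn0 => ->.
  by rewrite {2}/qpoch big_geq.
move=> cvgP1; apply: (cvgP (l + 1)).
have -> : qpoch a q = ((fun N => qpoch a q N - 1 : R[i]^o) \+ cst 1).
  by apply/funext => N; rewrite /= subrK.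
have c1 : cst (1 : R[i]^o) @ \oo --> (1 : R[i]^o) by exact: cvg_cst.
exact: (cvgD cvgP1 c1).
Qed.

(** * Finite boxes exhausting the strict overpartitions, and absolute convergence *)

Section Boxes.
Variable P : pred (seq (nat * bool)).

(** Used with [P] trivial and with [P] bounding the number of parts. Every list in [parts_lt N] is a
    strict overpartition, so [insub] discards nothing. *)
Definition box N : {fset strict_overpartition} :=
  [fset l in pmap insub [seq s <- parts_lt N | P s]]%fset.

Lemma partial_sum_box (V : zmodType) (g : seq (nat * bool) -> V) N :
  summability.partial_sum (fun l : strict_overpartition => g (val l)) (box N)
  = \sum_(s <- parts_lt N | P s) g s.
Proof.
rewrite partial_sum_fset_seq; last first.
  by rewrite pmap_sub_uniq // filter_uniq // uniq_parts_lt.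
rewrite big_pmap big_filter big_seq_cond [RHS]big_seq_cond.
apply: eq_bigr => s; rewrite mem_parts_lt => /andP[/andP[ss _] _].
by rewrite insubT.
Qed.

Lemma mem_box N (l : strict_overpartition) :
  (l \in box N) = P (val l) && (part (val l) 0 < N)%N.
Proof.
by rewrite inE /= mem_pmap_sub mem_filter mem_parts_lt (valP l).
Qed.

Lemma box_exhaust (J : {fset strict_overpartition}) :
  (forall l, l \in J -> P (val l)) ->
  \forall N \near \oo, (J `<=` box N)%fset.
Proof.
move=> JP; exists (\max_(l <- J) part (val l) 0).+1%N => // N /= ltN.
apply/fsubsetP => l lJ; rewrite mem_box JP //=; apply: leq_trans ltN.
by rewrite ltnS (leq_bigmax_seq (F := fun l => part (val l) 0)).
Qed.

End Boxes.

Lemma normr_op_term (K : numFieldType) (a q : K) s :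
  `|op_term a q s| = op_term `|a| `|q| s.
Proof. by rewrite /op_term normrM !normrX. Qed.

Lemma op_term_ge0 (K : numFieldType) (a q : K) s :
  0 <= a -> 0 <= q -> 0 <= op_term a q s.
Proof. by move=> a0 q0; rewrite mulr_ge0 // exprn_ge0. Qed.

(** The truncated sums increase with [N], so the two-step recurrence is at most the one-step one
    with factor [1 + (1 + a) * q ^+ N.+1]. *)
Lemma sum_parts_lt_le_prod (K : numFieldType) (a q : K) N :
  0 <= a -> 0 <= q ->
  sum_parts_lt a q N <= \prod_(0 <= i < N) (1 + (1 + a) * q ^+ i).
Proof.
move=> a0 q0; set y := sum_parts_lt a q.
have y0 n : 0 <= y n by apply: sumr_ge0 => s _; exact: op_term_ge0.
have y1 : y 1 = 1.
  by rewrite /y /sum_parts_lt /= big_cons big_nil /op_term big_nil /= !expr0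
    mulr1 addr0.
have mono n : y n <= y n.+1.
  case: n => [|n]; first by rewrite {1}/y /sum_parts_lt big_nil.
  rewrite /y sum_parts_ltSS mulrDl mul1r -addrA lerDl.
  by rewrite addr_ge0 // !mulr_ge0 // ?exprn_ge0 //; exact: y0.
case: N => [|N]; first by rewrite big_geq // /y /sum_parts_lt big_nil ler01.
elim: N => [|N IHN].
  by rewrite big_nat1 y1 lerDl mulr_ge0 ?exprn_ge0 // addr_ge0.
rewrite big_nat_recr //=.
have q0N := exprn_ge0 N.+1 q0.
apply: (@le_trans _ _ (y N.+1 * (1 + (1 + a) * q ^+ N.+1))).
  rewrite /y sum_parts_ltSS -/y -subr_ge0.
  rewrite (_ : _ - _ = a * q ^+ N.+1 * (y N.+1 - y N)); last by ring.
  by rewrite !mulr_ge0 // subr_ge0.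
by rewrite ler_wpM2r // addr_ge0 // mulr_ge0 // addr_ge0.
Qed.

Lemma sum_norm_op_term_bounded (R : realType) (a q : R[i]) : `|q| < 1 ->
  exists M : R[i], forall A : {fset strict_overpartition},
    \sum_(l <- A) op_term `|a| `|q| (val l) <= M.
Proof.
move=> q1; have a1 : 0 <= 1 + `|a| by rewrite addr_ge0.
have [M hM] := prod_geometric_bounded a1 q1.
exists M => A.
have [N _ /(_ N (leqnn _)) AN] := @box_exhaust xpredT A (fun _ _ => isT).
rewrite -partial_sumE (le_trans (le_partial_sum _ AN)) //.
  by move=> l; exact: op_term_ge0.
rewrite partial_sum_box (le_trans _ (hM N)) //.
exact: sum_parts_lt_le_prod.
Qed.

(** * The basic series as the sum classified by the number of parts *)

Lemma basic_term0 (K : numFieldType) (a q : K) : basic_term a q 0 = 1.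
Proof.
by rewrite /basic_term /qpoch !big_geq // mul0n div0n expr0 divr1 mulr1.
Qed.

Lemma basic_termS (K : numFieldType) (a q : K) n :
  basic_term a q n.+1
  = q ^+ n.+1 * (1 + a * q ^+ n.+1) / (1 - q ^+ n.+1) * basic_term a q n.
Proof.
rewrite /basic_term !qpochS invfM.
have -> : ((n.+1 * n.+2) %/ 2 = (n * n.+1) %/ 2 + n.+1)%N by lia.
by rewrite exprD !exprS; ring.
Qed.

Lemma subr1X_neq0 (K : numFieldType) (q : K) n : `|q| < 1 -> 1 - q ^+ n.+1 != 0.
Proof.
move=> q1; rewrite subr_eq0; apply/eqP => /(congr1 Num.norm)/eqP.
by rewrite normr1 normrX gt_eqF // exprn_ilt1.
Qed.

Lemma cvg_unique_seq (R : realType) (u : nat -> R[i]^o) (l l' : R[i]^o) :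
  u @ \oo --> l -> u @ \oo --> l' -> l = l'.
Proof. by move=> ul ul'; apply: cvg_unique ul ul'; exact: norm_hausdorff. Qed.

Section Convergence.
Variables (R : realType) (a q : R[i]).
Hypothesis q1 : `|q| < 1.

Lemma cvg_partial_sum_op_term (P : pred (seq (nat * bool))) :
  cvg (summability.partial_sum
    (fun l : strict_overpartition =>
       (if P (val l) then op_term a q (val l) else 0) : R[i]^o)
    @ summability.totally).
Proof.
have [M hM] := sum_norm_op_term_bounded a q1.
apply: (@cvg_partial_sum _ _ _ M) => A; apply: le_trans (hM A).
apply: ler_sum => l _; case: ifP => _; first by rewrite normr_op_term.
by rewrite normr0 op_term_ge0.
Qed.

Lemma cvg_overpartition_term :
  cvg (summability.partial_sum (overpartition_term a q) @ summability.totally).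
Proof.
have := @cvg_partial_sum_op_term xpredT.
have -> : (fun l : strict_overpartition =>
  (if xpredT (val l) then op_term a q (val l) else 0) : R[i]^o)
  = overpartition_term a q by apply/funext.
by [].
Qed.

Lemma cvg_sum_parts_lt :
  (sum_parts_lt a q : nat -> R[i]^o) @ \oo
  --> summability.sum (overpartition_term a q).
Proof.
have -> : sum_parts_lt a q = fun N =>
    summability.partial_sum (overpartition_term a q) (box xpredT N).
  by apply/funext => N; rewrite (partial_sum_box _ (op_term a q)).
apply: cvg_partial_sum_exhaust cvg_overpartition_term _ => J.
exact: box_exhaust.
Qed.

(** Absolute convergence first provides some limit [X]. The smallest-part recurrence in the limit is
    then a linear equation for [X], solvable because [1 - q ^+ n.+1] is nonzero, and it matches
    [basic_termS]. *)
Lemma cvg_sum_parts_lt_size n :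
  (sum_parts_lt_size a q N n : R[i]^o) @[N --> \oo] --> basic_term a q n.
Proof.
have ex m : exists X : R[i]^o,
    (sum_parts_lt_size a q N m : R[i]^o) @[N --> \oo] --> X.
  have /cvg_ex[X cX] := @cvg_partial_sum_op_term (fun s => size s == m).
  exists X; have -> : (fun N => sum_parts_lt_size a q N m) = fun N =>
      summability.partial_sum (fun l : strict_overpartition =>
        (if size (val l) == m then op_term a q (val l) else 0) : R[i]^o)
      (box xpredT N).
    apply/funext => N; rewrite /sum_parts_lt_size big_mkcond /=.
    exact/esym/(partial_sum_box _ (fun s => if size s == m then _ else _)).
  by apply: cvg_partial_sum_exhaust cX _ => J; exact: box_exhaust.
elim: n => [|n IHn].
  rewrite basic_term0 -cvg_shiftS.
  have -> : [sequence (sum_parts_lt_size a q N.+1 0 : R[i]^o)]_N = cst 1.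
    by apply/funext => N; rewrite /= sum_parts_lt_size0.
  exact: cvg_cst.
have [X cX] := ex n.+1.
suff <- : X = basic_term a q n.+1 by [].
have s1 (u : nat -> R[i]^o) (l : R[i]^o) :
    u @ \oo --> l -> u N.+1 @[N --> \oo] --> l.
  by rewrite cvg_shiftS.
have := s1 _ _ (s1 _ _ cX).
under eq_fun do rewrite sum_parts_lt_size_smallest.
move=> c1.
have c2 :
    (q ^+ n.+1
       * (sum_parts_lt_size a q N.+1 n.+1 + sum_parts_lt_size a q N.+1 n)
     + a * q ^+ (2 * n.+1) * sum_parts_lt_size a q N n : R[i]^o)
    @[N --> \oo] -->
    (q ^+ n.+1 * (X + basic_term a q n)
     + a * q ^+ (2 * n.+1) * basic_term a q n : R[i]^o).
  apply: (@cvgD R[i] R[i]^o).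
    apply: cvgMl_tmp; apply: (@cvgD R[i] R[i]^o).
      exact: s1 cX.
    exact: s1 IHn.
  exact: (@cvgMl_tmp R[i] _ _ _ _ (a * q ^+ (2 * n.+1)) _ IHn).
have := cvg_unique_seq c1 c2.
have qn := subr1X_neq0 n q1.
rewrite basic_termS mulnC exprM; move: (basic_term a q n) => t eX.
apply: (mulfI qn); rewrite mulrCA !mulrA divfK //.
rewrite mulrBl mul1r {1}eX.
by ring.
Qed.

Lemma sum_parts_lt_size_ltE M N :
  \sum_(s <- parts_lt N | (size s < M)%N) op_term a q s
  = \sum_(0 <= n < M) sum_parts_lt_size a q N n.
Proof.
elim: M => [|M IHM]; first by rewrite big_geq // big_pred0.
rewrite big_nat_recr //= -IHM (bigID (fun s => size s < M)%N) /=.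
by congr (_ + _); apply: eq_bigl => s; rewrite ltnS; lia.
Qed.

(** Regrouping by the number of parts. Take a finite [J] beyond which partial sums are within
    [e / 2] of the total, and [M] above all sizes in [J]. For large [N] the box of overpartitions
    with fewer than [M] parts contains [J], and its sum is also within [e / 2] of the [M]-th partial
    sum of the series. *)
Lemma cvg_series_basic_term :
  series (basic_term a q) @ \oo --> summability.sum (overpartition_term a q).
Proof.
apply/cvgrPdist_lt => e e0.
have e20 : 0 < e / 2 by rewrite divr_gt0.
have /cvgrPdist_lt/(_ _ e20)[J _ hJ] :
    summability.partial_sum (overpartition_term a q) @ summability.totally
    --> summability.sum (overpartition_term a q) := cvg_overpartition_term.
exists (\max_(l <- J) size (val l)).+1%N => // M /= ltM.
have JM l : l \in J -> (size (val l) < M)%N.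
  move=> lJ; apply: leq_trans ltM.
  by rewrite ltnS (leq_bigmax_seq (F := fun l => size (val l))).
have hN := @box_exhaust (fun s => size s < M)%N J JM.
have cM : (\sum_(0 <= n < M) sum_parts_lt_size a q N n : R[i]^o) @[N --> \oo]
    --> series (basic_term a q) M.
  rewrite /series /=; apply: cvg_big => [|n _]; first exact: add_continuous.
  exact: cvg_sum_parts_lt_size.
move/cvgrPdist_lt: cM => /(_ _ e20) cM.
near \oo => N.
rewrite [e]splitr.
have tri := ler_distD (\sum_(0 <= n < M) sum_parts_lt_size a q N n).
rewrite (le_lt_trans (tri _ _)) //.
rewrite ltrD //; last by rewrite distrC; near: N.
have := hJ (box (fun s => size s < M)%N N).
rewrite [summability.partial_sum _ _](partial_sum_box _ (op_term a q)).
by rewrite sum_parts_lt_size_ltE; apply; near: N.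
Unshelve. all: by end_near. Qed.

End Convergence.

(** * Telescoping of the basic series under the shift of [a] by [q ^+ 2] *)

Lemma qpochSl (K : numFieldType) (a q : K) N :
  qpoch a q N.+1 = (1 - a) * qpoch (a * q) q N.
Proof.
rewrite /qpoch big_nat_recl // expr0 mulr1; congr (_ * _).
by apply: eq_bigr => i _; rewrite exprS mulrA.
Qed.

Lemma basic_termSl (K : numFieldType) (a q : K) n :
  basic_term a q n.+1
  = q ^+ n.+1 * (1 + a * q) / (1 - q ^+ n.+1) * basic_term (a * q) q n.
Proof.
rewrite /basic_term qpochSl mulNr qpochS invfM.
have -> : ((n.+1 * n.+2) %/ 2 = (n * n.+1) %/ 2 + n.+1)%N by lia.
by rewrite exprD !exprS; ring.
Qed.

(** Both numerators are $(-aq;q)_{n+1}$, with its first or its last factor split off. *)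
Lemma basic_term_shift (K : numFieldType) (a q : K) n :
  (1 + a * q) * basic_term (a * q) q n = (1 + a * q ^+ n.+1) * basic_term a q n.
Proof.
have := qpochSl (- (a * q)) q n; rewrite qpochS.
rewrite !mulNr !opprK => e.
by rewrite /basic_term exprS !mulrA -e; ring.
Qed.

(* Found as [- (a q / (1 + a q)) (1 - q^n) t_n(a)], where [t_n(a)] is the general
   term; the form below cancels the factor [1 + a q], which may vanish. *)
Definition lebesgue_defect (K : numFieldType) (a q : K) (n : nat) : K^o :=
  if n is m.+1 then - (a * q * q ^+ n * basic_term (a * q) q m) else 0.

Lemma basic_term_telescope (K : numFieldType) (a q : K) n : `|q| < 1 ->
  basic_term a q n - (1 + a * q ^+ 2) * basic_term (a * q ^+ 2) q n
  = lebesgue_defect a q n.+1 - lebesgue_defect a q n.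
Proof.
move=> q1; rewrite expr2 mulrA basic_term_shift.
case: n => [|n] /=; first by rewrite !basic_term0 subr0; ring.
(* All terms are now multiples of [basic_term (a * q) q n], which leaves a rational identity in [a],
   [q] and [q ^+ n.+1]. *)
rewrite basic_termSl basic_termS.
have qn := subr1X_neq0 n q1.
move: (basic_term (a * q) q n) => t; rewrite [q ^+ n.+2]exprS.
by move: (q ^+ n.+1) qn => Q qn; field.
Qed.

Lemma series_basic_term_defect (K : numFieldType) (a q : K) N : `|q| < 1 ->
  series (basic_term a q) N
  - (1 + a * q ^+ 2) * series (basic_term (a * q ^+ 2) q) N
  = lebesgue_defect a q N.
Proof.
move=> q1; rewrite /series /= mulr_sumr -sumrB.
under eq_bigr do rewrite basic_term_telescope //.
by rewrite telescope_sumr // subr0.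
Qed.

(** * Limits and norm bounds for complex sequences *)

Lemma cvg_complex_expr (R : realType) (q : R[i]) : `|q| < 1 ->
  (q ^+ n : R[i]^o) @[n --> \oo] --> (0 : R[i]^o).
Proof.
move=> q1; pose r : R := complex.Re `|q|.
have rE : `|q| = r%:C by rewrite RRe_real // normr_real.
have r1 : `|r| < 1.
  by rewrite ger0_norm -?ler0c -?rE // -ltcR -rE rmorph1.
have /cvg_real_complex := cvg_expr r1.
move=> /cvgrPdist_lt h; apply/cvgrPdist_lt => e e0.
apply: filterS (h e e0) => n.
by rewrite rmorph0 !sub0r !normrN rmorphXn /= -rE normrX normr_id -normrX.
Qed.

Lemma norm_lim_le (R : realType) (u : nat -> R[i]^o) (l : R[i]^o) (B : R[i]) :
  u @ \oo --> l -> (forall n, `|u n| <= B) -> `|l| <= B.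
Proof.
move=> /cvgrPdist_lt ul uB.
(* The order on [R[i]] is partial, so negating an inequality requires both sides to be real. *)
have Breal : B \is Num.real by rewrite ger0_real // (le_trans _ (uB 0)).
rewrite real_leNgt // ?normr_real //; apply/negP => Bl.
have lB0 : 0 < `|l| - B by rewrite subr_gt0.
have [N _ /(_ N (leqnn N))] := ul _ lB0.
have := ler_distD (u N) l 0; rewrite !subr0 => tri /= lt.
have := le_lt_trans tri (ltr_leD lt (uB N)).
by rewrite subrK ltxx.
Qed.

(** * The functional equation in [a], its iteration, and the value at 0 *)

Section Lebesgue.
Variables (R : realType) (q : R[i]).
Hypothesis q1 : `|q| < 1.

Let S (a : R[i]) : R[i]^o := summability.sum (overpartition_term a q).

(** The limit of [series_basic_term_defect]: the defect vanishes because powers of [q] and the terms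
    of a convergent series both tend to 0. *)
Lemma sum_overpartition_functional a :
  S a = (1 + a * q ^+ 2) * S (a * q ^+ 2).
Proof.
have c1 := cvg_series_basic_term (a := a) q1.
have c2 := cvg_series_basic_term (a := a * q ^+ 2) q1.
have c3 := cvgB c1 (@cvgMl_tmp R[i] _ _ _ _ (1 + a * q ^+ 2) _ c2).
have c4 : lebesgue_defect a q @ \oo --> (0 : R[i]^o).
  rewrite -cvg_shiftS.
  have t0 : basic_term (a * q) q @ \oo --> (0 : R[i]^o).
    exact: cvg_series_cvg_0 (cvgP _ (cvg_series_basic_term (a := a * q) q1)).
  have Q0 : (q ^+ n.+1 : R[i]^o) @[n --> \oo] --> (0 : R[i]^o).
    by have := cvg_complex_expr q1; rewrite -cvg_shiftS.
  have -> : [sequence lebesgue_defect a q n.+1]_n = fun n =>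
      - (a * q) * (q ^+ n.+1 * basic_term (a * q) q n).
    by apply/funext => n /=; rewrite mulNr; congr (- _); exact/esym/mulrA.
  have Qt := @cvgM R[i] _ _ _ _ _ _ _ Q0 t0.
  have c4 := @cvgMl_tmp R[i] _ _ _ _ (- (a * q)) _ (Qt _).
  have e0 : - (a * q) * (0 * 0) = 0 by rewrite !mulr0.
  by move: c4; rewrite e0 => c4; exact: c4.
apply/eqP; rewrite -subr_eq0; apply/eqP.
apply: (cvg_unique_seq _ c4).
have -> : lebesgue_defect a q = fun N => series (basic_term a q) N
    - (1 + a * q ^+ 2) * series (basic_term (a * q ^+ 2) q) N.
  by apply/funext => N; rewrite series_basic_term_defect.
exact: c3.
Qed.

Lemma sum_overpartition_iter a K :
  S a = qpoch (- (a * q ^+ 2)) (q ^+ 2) K * S (a * (q ^+ 2) ^+ K).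
Proof.
elim: K => [|K IHK]; first by rewrite /qpoch big_geq // expr0 mul1r mulr1.
rewrite IHK sum_overpartition_functional qpochS.
move: (q ^+ 2) S => p T; rewrite exprSr mulNr opprK !mulrA.
by rewrite [a * p * _]mulrAC.
Qed.

(** Termwise, [b ^+ k - 0 ^+ k] is 0 for [k = 0] and otherwise has modulus at most that of [b]; what
    remains is the truncated sum at [a = 1] and the modulus of [q], which is bounded. *)
Lemma sum_overpartition_dist0 : exists M : R[i], forall b, `|b| <= 1 ->
  `|S b - S 0| <= `|b| * M.
Proof.
have [M hM] := prod_geometric_bounded (addr_ge0 ler01 (normr_ge0 1)) q1.
exists M => b b1.
apply: (@norm_lim_le _ (fun N => sum_parts_lt b q N - sum_parts_lt 0 q N)).
  exact: cvgB (cvg_sum_parts_lt (a := b) q1) (cvg_sum_parts_lt (a := 0) q1).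
move=> N; apply: le_trans (ler_wpM2l (normr_ge0 b) (hM N)).
apply: le_trans (ler_wpM2l (normr_ge0 b) (sum_parts_lt_le_prod _ _ _)) => //.
rewrite /sum_parts_lt -sumrB mulr_sumr (le_trans (ler_norm_sum _ _ _)) //.
apply: ler_sum => s _; rewrite /op_term normr1 expr1n mul1r.
rewrite -mulrBl normrM normrX ler_wpM2r ?exprn_ge0 //.
case: (count _ _) => [|k]; first by rewrite subrr normr0.
rewrite expr0n subr0 normrX exprS ler_piMr // exprn_ile1 //.
Qed.

Lemma cvg_sum_overpartition_0 (b p : R[i]) : `|p| < 1 ->
  S (b * p ^+ n) @[n --> \oo] --> S 0.
Proof.
move=> p1; have [M hM] := sum_overpartition_dist0.
have b0 : (b * p ^+ n : R[i]^o) @[n --> \oo] --> (0 : R[i]^o).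
  rewrite -(mulr0 b).
  exact: (@cvgMl_tmp R[i] _ _ _ _ b _ (cvg_complex_expr p1)).
have M0 : 0 <= M.
  by have := hM 1; rewrite normr1 mul1r => /(_ (lexx _)); exact: le_trans.
move/cvgrPdist_lt in b0; apply/cvgrPdist_lt => e e0.
(* [M] may be 0, hence the division by [M + 1]. Closeness within 1 puts the argument in the disc
   where the bound [hM] holds. *)
have M1 : 0 < M + 1 by rewrite ltr_wpDl.
have h1 := b0 1 ltr01; have h2 := b0 (e / (M + 1)) (divr_gt0 e0 M1).
apply: filterS2 h1 h2 => n; rewrite !sub0r !normrN => l1 l2.
rewrite distrC (le_lt_trans (hM _ (ltW l1))) //.
apply: le_lt_trans (_ : `|b * p ^+ n| * (M + 1) < e).
  by rewrite ler_wpM2l // lerDl.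
by rewrite -ltr_pdivlMr.
Qed.

(** At [a = 0] only lists without overlines count, and each of the parts 1 to [N] is freely present
    or absent. *)
Lemma sum_parts_lt0a N : sum_parts_lt 0 q N.+1 = qpoch (- q) q N.
Proof.
elim: N => [|N IHN].
  by rewrite /sum_parts_lt /= big_cons big_nil /op_term big_nil /= !expr0
    mulr1 addr0 /qpoch big_geq.
by rewrite sum_parts_ltSS IHN qpochS mulNr opprK -exprS !mul0r addr0 mulrC.
Qed.

Lemma qpoch_inf_sum_overpartition : qpoch_inf (- q) q = S 0.
Proof.
apply: cvg_lim; first exact: norm_hausdorff.
have := cvg_sum_parts_lt (a := 0) q1; rewrite -cvg_shiftS.
under eq_fun do rewrite sum_parts_lt0a.
exact.
Qed.

End Lebesgue.

Theorem theorem4p6 (R : realType) (a q : R[i]) (hq : `|q| < 1) :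
  [/\ cvg (summability.partial_sum (overpartition_term a q)
             @ summability.totally),
      cvgn (series (basic_term a q)),
      cvgn (qpoch (- (a * q ^+ 2)) (q ^+ 2) : nat -> R[i]^o),
      cvgn (qpoch (- q) q : nat -> R[i]^o)
    & summability.sum (overpartition_term a q) = limn (series (basic_term a q))
      /\ limn (series (basic_term a q))
         = qpoch_inf (- (a * q ^+ 2)) (q ^+ 2) * qpoch_inf (- q) q].
Proof.
have cS := cvg_series_basic_term (a := a) hq.
have q2 : `|q ^+ 2| < 1 by rewrite normrX exprn_ilt1.
have cP := cvg_qpoch (a := - (a * q ^+ 2)) q2.
have eS : limn (series (basic_term a q))
    = summability.sum (overpartition_term a q).
  by apply: cvg_lim cS; exact: norm_hausdorff.
split; [exact: cvg_overpartition_term|exact: cvgP cS|exact: cP|exact: cvg_qpoch|].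
rewrite eS; split; first by [].
have cF := @cvgM R[i] _ _ _ _ _ _ _ cP (@cvg_sum_overpartition_0 _ _ hq a _ q2).
apply: (cvg_unique_seq _ _ : _ = _); last first.
  rewrite (qpoch_inf_sum_overpartition hq); exact: cF.
(* By the iterated functional equation this product sequence is constant, so its limit can be read
   in two ways. *)
have -> : qpoch (- (a * q ^+ 2)) (q ^+ 2)
    \* (fun n => summability.sum (overpartition_term (a * (q ^+ 2) ^+ n) q))
  = cst (summability.sum (overpartition_term a q)).
  by apply/funext => n /=; rewrite -sum_overpartition_iter.
exact: cvg_cst.
Qed.
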